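(* Let $\mathcal{M}$ be a subcategory of $\mathcal{B}$ which contains all projective objects of $\mathcal{B}$. If $\mathcal{M}$ is rigid and contravariantly finite, then $\mathcal{M}_L/[\mathcal{M}]$ is abelian.
   Context: $k$ is a field and $\mathcal{B}$ is a $k$-linear, Hom-finite, Krull-Schmidt exact category (in the sense of Quillen) with enough projectives and enough injectives. Subcategories are full and closed under isomorphisms and finite direct sums. $\mathcal{M}$ is rigid if $\operatorname{Ext}^1_{\mathcal{B}}(M,M')=0$ for all $M,M'\in\mathcal{M}$. $\mathcal{M}$ is contravariantly finite in $\mathcal{B}$ if every $B\in\mathcal{B}$ admits a morphism $f:M\to B$ with $M\in\mathcal{M}$ such that every morphism from an object of $\mathcal{M}$ to $B$ factors through $f$. $\mathcal{M}_L$ is the full subcategory of objects $X\in\mathcal{B}$ admitting a short exact sequence $0\to X\to M^0\to M^1\to 0$ with $M^0,M^1\in\mathcal{M}$. $\mathcal{M}_L/[\mathcal{M}]$ is the category with the same objects as $\mathcal{M}_L$ and morphisms $\operatorname{Hom}_{\mathcal{B}}(X,Y)/[\mathcal{M}](X,Y)$, where $[\mathcal{M}](X,Y)$ is the set of morphisms factoring through an object of $\mathcal{M}$. *)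

(* Defs.v *)
From HB Require Import structures.
From mathcomp Require Import all_boot all_algebra ring_quotient.
From mathcomp Require Import boolp.

Set Implicit Arguments.
Unset Strict Implicit.
Unset Printing Implicit Defensive.

Import GRing.Theory.
Local Open Scope ring_scope.
Local Open Scope quotient_scope.

Reserved Notation "g \oc f" (at level 40, left associativity).

Record linCat (k : fieldType) := LinCat {
  obj :> Type;
  Mor : obj -> obj -> lmodType k;
  idm : forall X : obj, Mor X X;
  morcomp : forall X Y Z : obj, Mor Y Z -> Mor X Y -> Mor X Z;
  morcompA : forall (X Y Z T : obj) (h : Mor Z T) (g : Mor Y Z) (f : Mor X Y),
    morcomp h (morcomp g f) = morcomp (morcomp h g) f;
  comp1m : forall (X Y : obj) (f : Mor X Y), morcomp (idm Y) f = f;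
  compm1 : forall (X Y : obj) (f : Mor X Y), morcomp f (idm X) = f;
  comp_linearl : forall (X Y Z : obj) (f : Mor X Y),
    linear (fun g : Mor Y Z => morcomp g f);
  comp_linearr : forall (X Y Z : obj) (g : Mor Y Z),
    linear (fun f : Mor X Y => morcomp g f)
}.

Notation "g \oc f" := (morcomp g f).

Section LinCatTheory.
Variables (k : fieldType) (C : linCat k).
Implicit Types X Y Z : C.

Lemma compBl X Y Z (g g' : Mor Y Z) (f : Mor X Y) :
  (g - g') \oc f = g \oc f - g' \oc f.
Proof. by rewrite addrC -scaleN1r comp_linearl scaleN1r addrC. Qed.

Lemma compBr X Y Z (g : Mor Y Z) (f f' : Mor X Y) :
  g \oc (f - f') = g \oc f - g \oc f'.
Proof. by rewrite addrC -scaleN1r comp_linearr scaleN1r addrC. Qed.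

Lemma comp0m X Y Z (f : Mor X Y) : (0 : Mor Y Z) \oc f = 0.
Proof. by rewrite -[X in X \oc f](subrr 0) compBl subrr. Qed.

Lemma compm0 X Y Z (g : Mor Y Z) : g \oc (0 : Mor X Y) = 0.
Proof. by rewrite -[X in g \oc X](subrr 0) compBr subrr. Qed.

End LinCatTheory.

Section LinCatNotions.
Variables (k : fieldType) (C : linCat k).
Implicit Types X Y Z T : C.

Definition is_iso X Y (f : Mor X Y) : Prop :=
  exists g : Mor Y X, g \oc f = idm X /\ f \oc g = idm Y.

Definition mono X Y (f : Mor X Y) : Prop :=
  forall T (u v : Mor T X), f \oc u = f \oc v -> u = v.

Definition epi X Y (f : Mor X Y) : Prop :=
  forall T (u v : Mor Y T), u \oc f = v \oc f -> u = v.

Definition is_kernel X Y Z (f : Mor Y Z) (i : Mor X Y) : Prop :=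
  f \oc i = 0 /\
  forall T (t : Mor T Y), f \oc t = 0 -> exists! u : Mor T X, i \oc u = t.

Definition is_cokernel X Y Z (f : Mor X Y) (p : Mor Y Z) : Prop :=
  p \oc f = 0 /\
  forall T (t : Mor Y T), t \oc f = 0 -> exists! u : Mor Z T, u \oc p = t.

(* The square f' \oc i = i' \oc f is cocartesian:
     X --i--> Y
     |f       |f'
     X' -i'-> Y'                                                            *)
Definition is_pushout X Y X' Y' (i : Mor X Y) (f : Mor X X')
    (i' : Mor X' Y') (f' : Mor Y Y') : Prop :=
  f' \oc i = i' \oc f /\
  forall T (u : Mor Y T) (v : Mor X' T), u \oc i = v \oc f ->
    exists! w : Mor Y' T, w \oc f' = u /\ w \oc i' = v.

(* The square p \oc f' = f \oc p' is cartesian: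
     Y' -p'-> Z'
     |f'      |f
     Y --p--> Z                                                             *)
Definition is_pullback Y Z Y' Z' (p : Mor Y Z) (f : Mor Z' Z)
    (p' : Mor Y' Z') (f' : Mor Y' Y) : Prop :=
  p \oc f' = f \oc p' /\
  forall T (u : Mor T Y) (v : Mor T Z'), p \oc u = f \oc v ->
    exists! w : Mor T Y', f' \oc w = u /\ p' \oc w = v.

(* X is a direct sum of the family E; for n = 0, X is a zero object. *)
Definition is_dirsum n (E : 'I_n -> C) X : Prop :=
  exists (inj : forall i, Mor (E i) X) (proj : forall i, Mor X (E i)),
  [/\ forall i, proj i \oc inj i = idm (E i),
      forall i j, i != j -> proj i \oc inj j = 0 &
      \sum_(i < n) inj i \oc proj i = idm X].

Definition additive_cat : Prop :=
  forall n (E : 'I_n -> C), exists X, is_dirsum E X.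

Definition hom_finite : Prop :=
  forall X Y, exists (n : nat) (e : 'I_n -> Mor X Y),
    forall f : Mor X Y, exists c : 'I_n -> k, f = \sum_(i < n) c i *: e i.

(* The ring End(X) is local: it is nonzero and its non-units are closed
   under addition. *)
Definition local_end X : Prop :=
  idm X <> 0 /\
  forall f g : Mor X X, ~ is_iso f -> ~ is_iso g -> ~ is_iso (f + g).

Definition krull_schmidt : Prop :=
  forall X, exists (n : nat) (E : 'I_n -> C),
    is_dirsum E X /\ forall i, local_end (E i).

Definition abelian_cat : Prop :=
  [/\ additive_cat,
      forall X Y (f : Mor X Y), exists (K : C) (i : Mor K X), is_kernel f i,
      forall X Y (f : Mor X Y), exists (K : C) (p : Mor Y K), is_cokernel f p,
      forall X Y (f : Mor X Y), mono f ->
        exists Z (g : Mor Y Z), is_kernel g f &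
      forall X Y (f : Mor X Y), epi f ->
        exists Z (g : Mor Z X), is_cokernel g f].

End LinCatNotions.

(* A Quillen exact structure in the axiomatization of Keller and Buehler;
   conflations are the distinguished short exact sequences. *)
Section Conflations.
Variables (k : fieldType) (C : linCat k).
Variable confl : forall X Y Z : C, Mor X Y -> Mor Y Z -> Prop.

Definition is_inflation (X Y : C) (i : Mor X Y) : Prop :=
  exists (Z : C) (p : Mor Y Z), confl i p.

Definition is_deflation (Y Z : C) (p : Mor Y Z) : Prop :=
  exists (X : C) (i : Mor X Y), confl i p.

Record exact_structure : Prop := ExactStructure {
  confl_kernel : forall (X Y Z : C) (i : Mor X Y) (p : Mor Y Z),
    confl i p -> is_kernel p i;
  confl_cokernel : forall (X Y Z : C) (i : Mor X Y) (p : Mor Y Z),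
    confl i p -> is_cokernel i p;
  confl_iso : forall (X Y Z X' Y' Z' : C) (i : Mor X Y) (p : Mor Y Z)
      (i' : Mor X' Y') (p' : Mor Y' Z')
      (a : Mor X X') (b : Mor Y Y') (c : Mor Z Z'),
    is_iso a -> is_iso b -> is_iso c ->
    b \oc i = i' \oc a -> c \oc p = p' \oc b -> confl i p -> confl i' p';
  inflation_id : forall X : C, is_inflation (idm X);
  deflation_id : forall X : C, is_deflation (idm X);
  inflation_comp : forall (X Y Z : C) (g : Mor Y Z) (f : Mor X Y),
    is_inflation g -> is_inflation f -> is_inflation (g \oc f);
  deflation_comp : forall (X Y Z : C) (g : Mor Y Z) (f : Mor X Y),
    is_deflation g -> is_deflation f -> is_deflation (g \oc f);
  inflation_pushout : forall (X Y X' : C) (i : Mor X Y) (f : Mor X X'),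
    is_inflation i ->
    exists (Y' : C) (i' : Mor X' Y') (f' : Mor Y Y'),
      is_pushout i f i' f' /\ is_inflation i';
  deflation_pullback : forall (Y Z Z' : C) (p : Mor Y Z) (f : Mor Z' Z),
    is_deflation p ->
    exists (Y' : C) (p' : Mor Y' Z') (f' : Mor Y' Y),
      is_pullback p f p' f' /\ is_deflation p'
}.

End Conflations.

Record exactCat (k : fieldType) := ExactCat {
  underlying :> linCat k;
  exact_additive : additive_cat underlying;
  conflation : forall X Y Z : underlying, Mor X Y -> Mor Y Z -> Prop;
  exact_exact : exact_structure conflation
}.

Section ExactCatNotions.
Variables (k : fieldType) (B : exactCat k).
Implicit Types X Y Z P I : B.

Definition inflation X Y (i : Mor X Y) := is_inflation (@conflation k B) i.
Definition deflation Y Z (p : Mor Y Z) := is_deflation (@conflation k B) p.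

Definition is_projective P : Prop :=
  forall Y Z (p : Mor Y Z), deflation p ->
  forall f : Mor P Z, exists g : Mor P Y, p \oc g = f.

Definition is_injective I : Prop :=
  forall X Y (i : Mor X Y), inflation i ->
  forall f : Mor X I, exists g : Mor Y I, g \oc i = f.

Definition enough_projectives : Prop :=
  forall X, exists P (p : Mor P X), is_projective P /\ deflation p.

Definition enough_injectives : Prop :=
  forall X, exists I (i : Mor X I), is_injective I /\ inflation i.

(* Ext^1 is the Yoneda Ext group: equivalence classes of extensions
   0 -> X -> E -> Z -> 0, whose zero element is the class of the split
   extension on X (+) Z. *)
Record extension Z X := Extension {
  ext_mid : B;
  ext_inj : Mor X ext_mid;
  ext_prj : Mor ext_mid Z;
  ext_confl : conflation ext_inj ext_prj
}.

Definition ext_equiv Z X (e e' : extension Z X) : Prop :=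
  exists h : Mor (ext_mid e) (ext_mid e'),
    h \oc ext_inj e = ext_inj e' /\ ext_prj e' \oc h = ext_prj e.

Definition ext_split Z X (e : extension Z X) : Prop :=
  exists (r : Mor (ext_mid e) X) (s : Mor Z (ext_mid e)),
  [/\ r \oc ext_inj e = idm X, ext_prj e \oc s = idm Z, r \oc s = 0 &
      ext_inj e \oc r + s \oc ext_prj e = idm (ext_mid e)].

Definition Ext1_zero Z X : Prop :=
  forall e : extension Z X, exists e0, ext_split e0 /\ ext_equiv e e0.

End ExactCatNotions.

(* A full subcategory closed under isomorphisms and finite direct sums; the
   empty direct sum is included, so that zero objects belong to it. *)
Record subcat (k : fieldType) (C : linCat k) := Subcat {
  in_subcat :> C -> Prop;
  subcat_iso : forall (X Y : C) (f : Mor X Y),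
    is_iso f -> in_subcat X -> in_subcat Y;
  subcat_dirsum : forall n (E : 'I_n -> C) (X : C),
    (forall i, in_subcat (E i)) -> is_dirsum E X -> in_subcat X
}.

Section SubcatNotions.
Variables (k : fieldType) (B : exactCat k) (M : subcat B).

Definition rigid : Prop := forall X Y : B, M X -> M Y -> Ext1_zero X Y.

Definition contravariantly_finite : Prop :=
  forall X : B, exists (N : B) (f : Mor N X), M N /\
    forall (N' : B) (g : Mor N' X), M N' -> exists h : Mor N' N, f \oc h = g.

Definition ML (X : B) : Prop :=
  exists (M0 M1 : B) (i : Mor X M0) (p : Mor M0 M1),
    [/\ M M0, M M1 & conflation i p].

End SubcatNotions.

Section FullSubcategory.
Variables (k : fieldType) (C : linCat k) (P : C -> Prop).

Definition full_subcat : linCat k :=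
  @LinCat k {X : C | P X}
    (fun X Y => Mor (sval X) (sval Y))
    (fun X => idm (sval X))
    (fun X Y Z g f => g \oc f)
    (fun X Y Z T => @morcompA k C (sval X) (sval Y) (sval Z) (sval T))
    (fun X Y => @comp1m k C (sval X) (sval Y))
    (fun X Y => @compm1 k C (sval X) (sval Y))
    (fun X Y Z => @comp_linearl k C (sval X) (sval Y) (sval Z))
    (fun X Y Z => @comp_linearr k C (sval X) (sval Y) (sval Z)).

End FullSubcategory.

Section LmodQuotient.
Variables (k : fieldType) (V : lmodType k) (S : zmodClosed V).
Variable scaleS : scaler_closed S.

(* The library's quotient by a subgroup; the phantom argument lets the scaling
   be inferred. *)
Definition lmod_quot_of of scaler_closed S := Quotient.quot S.
Local Notation lmod_quot := (lmod_quot_of scaleS).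

HB.instance Definition _ := GRing.Zmodule.on lmod_quot.
HB.instance Definition _ := EqQuotient.on lmod_quot.

Lemma lmod_quotP (x y : V) :
  x - y \in S <-> \pi_lmod_quot x = \pi_lmod_quot y.
Proof. by rewrite Quotient.idealrBE; split=> /eqP. Qed.

Lemma lmod_quotD (x y : V) :
  \pi_lmod_quot (x + y) = \pi_lmod_quot x + \pi_lmod_quot y.
Proof. exact: (raddfD \pi_(Quotient.quot S)). Qed.

Definition lmod_quot_scale (a : k) (x : lmod_quot) : lmod_quot :=
  \pi_lmod_quot (a *: repr x).

Lemma lmod_quotZ_subproof a (x : V) :
  lmod_quot_scale a (\pi_lmod_quot x) = \pi_lmod_quot (a *: x).
Proof.
apply/lmod_quotP; rewrite -scalerBr; apply: scaleS.
by apply/lmod_quotP; rewrite reprK.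
Qed.

Fact lmod_quot_scaleA a b x :
  lmod_quot_scale a (lmod_quot_scale b x) = lmod_quot_scale (a * b) x.
Proof.
elim/quotW: x => x.
by rewrite (lmod_quotZ_subproof b x) !lmod_quotZ_subproof scalerA.
Qed.

Fact lmod_quot_scale1 : left_id 1 lmod_quot_scale.
Proof. by elim/quotW=> x; rewrite lmod_quotZ_subproof scale1r. Qed.

Fact lmod_quot_scaleDr : right_distributive lmod_quot_scale +%R.
Proof.
move=> a; elim/quotW=> x; elim/quotW=> y; rewrite -lmod_quotD.
by rewrite !lmod_quotZ_subproof scalerDr lmod_quotD.
Qed.

Fact lmod_quot_scaleDl x : {morph lmod_quot_scale^~ x : a b / a + b}.
Proof.
move=> a b; elim/quotW: x => x /=.
by rewrite !lmod_quotZ_subproof scalerDl lmod_quotD.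
Qed.

HB.instance Definition _ := GRing.Zmodule_isLmodule.Build k lmod_quot
  lmod_quot_scaleA lmod_quot_scale1 lmod_quot_scaleDr lmod_quot_scaleDl.

Lemma lmod_quotZ a (x : V) :
  \pi_lmod_quot (a *: x) = a *: \pi_lmod_quot x.
Proof. by rewrite -lmod_quotZ_subproof. Qed.

End LmodQuotient.

Record ideal (k : fieldType) (C : linCat k) := Ideal {
  ideal_hom : forall X Y : C, zmodClosed (Mor X Y);
  ideal_scale : forall X Y : C, scaler_closed (ideal_hom X Y);
  ideal_comp : forall (X Y Z : C) (g : Mor Y Z) (f : Mor X Y),
    (g \in ideal_hom Y Z) || (f \in ideal_hom X Y) ->
    g \oc f \in ideal_hom X Z
}.

Section QuotientCategory.
Variables (k : fieldType) (C : linCat k) (I : ideal C).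

Definition qhom (X Y : C) : lmodType k := lmod_quot_of (@ideal_scale k C I X Y).

Definition qpi (X Y : C) (f : Mor X Y) : qhom X Y :=
  \pi_(lmod_quot_of (@ideal_scale k C I X Y)) f.

Definition qcomp (X Y Z : C) (g : qhom Y Z) (f : qhom X Y) : qhom X Z :=
  qpi (repr g \oc repr f).

Lemma qpiP (X Y : C) (f g : Mor X Y) :
  f - g \in ideal_hom I X Y <-> qpi f = qpi g.
Proof. exact: lmod_quotP. Qed.

Lemma qpi_surj (X Y : C) (f : qhom X Y) : qpi (repr f) = f.
Proof. exact: reprK. Qed.

Lemma qpi_linear (X Y : C) : linear (@qpi X Y).
Proof. by move=> a f g; rewrite /qpi lmod_quotD lmod_quotZ. Qed.

Lemma qpi_comp (X Y Z : C) (g : Mor Y Z) (f : Mor X Y) :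
  qcomp (qpi g) (qpi f) = qpi (g \oc f).
Proof.
apply/qpiP; set g' := repr _; set f' := repr _.
have -> : g' \oc f' - g \oc f = g' \oc (f' - f) + (g' - g) \oc f.
  by rewrite compBr compBl addrA subrK.
apply: rpredD; apply: ideal_comp; apply/orP; [right|left];
  by apply/qpiP; rewrite qpi_surj.
Qed.

Fact qcompA (X Y Z T : C) (h : qhom Z T) (g : qhom Y Z) (f : qhom X Y) :
  qcomp h (qcomp g f) = qcomp (qcomp h g) f.
Proof.
by rewrite -[h]qpi_surj -[g]qpi_surj -[f]qpi_surj !qpi_comp morcompA.
Qed.

Fact qcomp1m (X Y : C) (f : qhom X Y) : qcomp (qpi (idm Y)) f = f.
Proof. by rewrite -[f]qpi_surj qpi_comp comp1m. Qed.

Fact qcompm1 (X Y : C) (f : qhom X Y) : qcomp f (qpi (idm X)) = f.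
Proof. by rewrite -[f]qpi_surj qpi_comp compm1. Qed.

Fact qcomp_linearl (X Y Z : C) (f : qhom X Y) :
  linear (fun g : qhom Y Z => qcomp g f).
Proof.
move=> a g h; rewrite -[f]qpi_surj -[g]qpi_surj -[h]qpi_surj -qpi_linear.
by rewrite !qpi_comp comp_linearl qpi_linear.
Qed.

Fact qcomp_linearr (X Y Z : C) (g : qhom Y Z) :
  linear (fun f : qhom X Y => qcomp g f).
Proof.
move=> a f h; rewrite -[f]qpi_surj -[g]qpi_surj -[h]qpi_surj -qpi_linear.
by rewrite !qpi_comp comp_linearr qpi_linear.
Qed.

Definition quot_cat : linCat k :=
  LinCat qcompA qcomp1m qcompm1 qcomp_linearl qcomp_linearr.

End QuotientCategory.

Section FactorIdeal.
Variables (k : fieldType) (B : exactCat k) (M : subcat B).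

Definition factors (X Y : B) (f : Mor X Y) : Prop :=
  exists (N : B) (h : Mor N Y) (g : Mor X N), M N /\ f = h \oc g.

Definition factors_pred (X Y : B) : {pred Mor X Y} :=
  fun f => `[< factors f >].

Fact factors_submod (X Y : B) : submod_closed (@factors_pred X Y).
Proof.
split.
  have [N dN] := @exact_additive k B 0 (fun i : 'I_0 => X).
  apply/asboolP; exists N, 0, 0; split; last by rewrite comp0m.
  by apply: subcat_dirsum dN; case.
move=> a f f' /asboolP[N [h [g [MN ->]]]] /asboolP[N' [h' [g' [MN' ->]]]].
pose E (i : 'I_2) : B := if val i == 0%N then N else N'.
have [S dS] := @exact_additive k B 2 E.
have MS : M S by apply: subcat_dirsum dS => i; rewrite /E; case: ifP.
have [inj [proj [pi1 pi0 _]]] := dS.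
pose i0 : 'I_2 := ord0; pose i1 : 'I_2 := Ordinal (isT : 1 < 2)%N.
have p00 : proj i0 \oc inj i0 = idm N := pi1 i0.
have p11 : proj i1 \oc inj i1 = idm N' := pi1 i1.
have p01 : proj i0 \oc inj i1 = 0 :> Mor N' N by exact: (pi0 i0 i1).
have p10 : proj i1 \oc inj i0 = 0 :> Mor N N' by exact: (pi0 i1 i0).
move: (inj i0) (inj i1) (proj i0) (proj i1) p00 p11 p01 p10.
rewrite /E /= => j0 j1 q0 q1 p00 p11 p01 p10.
apply/asboolP.
exists S, (a *: (h \oc q0) + h' \oc q1), (1 *: (j0 \oc g) + j1 \oc g').
split=> //.
rewrite comp_linearl !comp_linearr scale1r !morcompA.
rewrite -!(morcompA _ q0) -!(morcompA _ q1).
rewrite p00 p11 p01 p10 !compm1.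
by rewrite !compm0 !comp0m !scale1r addr0 add0r.
Qed.

HB.instance Definition _ (X Y : B) :=
  GRing.isZmodClosed.Build (Mor X Y) (@factors_pred X Y)
    (GRing.submod_closedB (@factors_submod X Y)).

Fact factors_scale (X Y : B) : scaler_closed (@factors_pred X Y).
Proof. exact: GRing.subsemimod_closedZ (factors_submod X Y). Qed.

Fact factors_comp (X Y Z : B) (g : Mor Y Z) (f : Mor X Y) :
  (g \in @factors_pred Y Z) || (f \in @factors_pred X Y) ->
  g \oc f \in @factors_pred X Z.
Proof.
case/orP=> /asboolP[N [h [l [MN ->]]]]; apply/asboolP.
  by exists N, h, (l \oc f); rewrite morcompA.
by exists N, (g \oc h), l; rewrite morcompA.
Qed.

Definition factor_ideal : ideal B :=
  @Ideal k B (fun X Y => @factors_pred X Y) factors_scale factors_comp.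

Definition ML_mod_M : linCat k :=
  full_subcat (C := quot_cat factor_ideal) (ML M).

End FactorIdeal.

(* Main.v *)
(* Let X -i-> M0 -q-> M1 be a conflation with M0, M1 in M, and f : X -> Y. By
   rigidity i is a left M-approximation, so f factors through M iff it factors
   through i. The pushout Z of i along f lies in ML (it is an extension of M1 by
   Y), and Y -> Z is a cokernel of f modulo [M]. For a right approximation
   N -> Z, pull X -> M0 -> M1 back along N -> Z -> M1 to a conflation
   X -> E -> N, choose a deflation N0 -> E which is a right M-approximation, and
   let K be the kernel of N0 -> E -> N. Then K lies in ML and the induced map
   K -> X is a kernel of f modulo [M]. If f is a monomorphism modulo [M], then
   K -> X factors through M; hence X -> E -> N splits for every N -> Z with N in
   M, so a map into Y killed by Y -> Z modulo [M] comes from X. If f is an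
   epimorphism modulo [M], then Z is a retract of an object of M, so E is large
   enough to extend to Y the maps out of X killed by K -> X modulo [M]. *)

Require Import Defs.
From mathcomp Require Import all_boot all_algebra.
From mathcomp Require Import boolp.

Set Implicit Arguments.
Unset Strict Implicit.
Unset Printing Implicit Defensive.

Import GRing.Theory.
Local Open Scope ring_scope.

(** * Limits, colimits and biproducts in a linear category *)

Section LinearCategory.
Variables (k : fieldType) (C : linCat k).
Implicit Types X Y Z T : C.

Lemma compDl X Y Z (g g' : Mor Y Z) (f : Mor X Y) :
  (g + g') \oc f = g \oc f + g' \oc f.
Proof. by have := comp_linearl f 1 g g'; rewrite !scale1r. Qed.

Lemma compDr X Y Z (g : Mor Y Z) (f f' : Mor X Y) :
  g \oc (f + f') = g \oc f + g \oc f'.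
Proof. by have := comp_linearr g 1 f f'; rewrite !scale1r. Qed.

Lemma compNl X Y Z (g : Mor Y Z) (f : Mor X Y) : (- g) \oc f = - (g \oc f).
Proof. by rewrite -[- g]sub0r compBl comp0m sub0r. Qed.

Lemma is_iso_id X : is_iso (idm X).
Proof. by exists (idm X); rewrite comp1m. Qed.

Lemma kernel_mono X Y Z (f : Mor Y Z) (i : Mor X Y) : is_kernel f i -> mono i.
Proof.
case=> fi0 ker T u v iuv; have [|w [_ w_uniq]] := ker T (i \oc v).
  by rewrite morcompA fi0 comp0m.
by rewrite -(w_uniq u) // (w_uniq v).
Qed.

Lemma cokernel_epi X Y Z (f : Mor X Y) (p : Mor Y Z) : is_cokernel f p -> epi p.
Proof.
case=> pf0 coker T u v upv; have [|w [_ w_uniq]] := coker T (v \oc p).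
  by rewrite -morcompA pf0 compm0.
by rewrite -(w_uniq u) // (w_uniq v).
Qed.

Lemma kernel_lift X Y Z (f : Mor Y Z) (i : Mor X Y) T (t : Mor T Y) :
  is_kernel f i -> f \oc t = 0 -> exists u, i \oc u = t.
Proof. by case=> _ ker /ker[u [iu _]]; exists u. Qed.

Lemma cokernel_desc X Y Z (f : Mor X Y) (p : Mor Y Z) T (t : Mor Y T) :
  is_cokernel f p -> t \oc f = 0 -> exists u, u \oc p = t.
Proof. by case=> _ coker /coker[u [up _]]; exists u. Qed.

Lemma kernel_unique X X' Y Z (p : Mor Y Z) (i : Mor X Y) (i' : Mor X' Y) :
  is_kernel p i -> is_kernel p i' -> exists2 a, is_iso a & i' \oc a = i.
Proof.
move=> ki ki'; have [a ia] := kernel_lift ki' (proj1 ki).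
have [b ib] := kernel_lift ki (proj1 ki').
exists a => //; exists b; split.
  by apply: (kernel_mono ki); rewrite morcompA ib ia compm1.
by apply: (kernel_mono ki'); rewrite morcompA ia ib compm1.
Qed.

Lemma cokernel_unique X Y Z Z' (i : Mor X Y) (p : Mor Y Z) (p' : Mor Y Z') :
  is_cokernel i p -> is_cokernel i p' -> exists2 c, is_iso c & c \oc p = p'.
Proof.
move=> cp cp'; have [a pa] := cokernel_desc cp (proj1 cp').
have [b pb] := cokernel_desc cp' (proj1 cp).
exists a => //; exists b; split.
  by apply: (cokernel_epi cp); rewrite -morcompA pa pb comp1m.
by apply: (cokernel_epi cp'); rewrite -morcompA pb pa comp1m.
Qed.

Lemma pushout_sym X Y X' Y' (i : Mor X Y) (f : Mor X X')
    (i' : Mor X' Y') (f' : Mor Y Y') :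
  is_pushout i f i' f' -> is_pushout f i f' i'.
Proof.
case=> comm univ; split=> // T u v uv.
have [//|w [[wf wi] w_uniq]] := univ T v u; exists w.
by split=> // w' [w'i w'f]; apply: w_uniq.
Qed.

Lemma pushout_epi X Y X' Y' (i : Mor X Y) (f : Mor X X')
    (i' : Mor X' Y') (f' : Mor Y Y') T (u v : Mor Y' T) :
  is_pushout i f i' f' -> u \oc f' = v \oc f' -> u \oc i' = v \oc i' -> u = v.
Proof.
case=> comm univ uvf uvi; have [|w [_ w_uniq]] := univ T (v \oc f') (v \oc i').
  by rewrite -!morcompA comm.
by rewrite -(w_uniq u) // (w_uniq v).
Qed.

Lemma pushout_desc X Y X' Y' (i : Mor X Y) (f : Mor X X')
    (i' : Mor X' Y') (f' : Mor Y Y') T (u : Mor Y T) (v : Mor X' T) :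
  is_pushout i f i' f' -> u \oc i = v \oc f ->
  exists w, w \oc f' = u /\ w \oc i' = v.
Proof. by case=> _ univ /univ[w [? _]]; exists w. Qed.

Lemma pushout_unique X Y X' Y' Y1 (i : Mor X Y) (f : Mor X X')
    (i' : Mor X' Y') (f' : Mor Y Y') (i1 : Mor X' Y1) (f1 : Mor Y Y1) :
  is_pushout i f i1 f1 -> is_pushout i f i' f' ->
  exists2 b, is_iso b & b \oc i1 = i'.
Proof.
move=> po1 po; have [b [bf bi]] := pushout_desc po1 (proj1 po).
have [a [af ai]] := pushout_desc po (proj1 po1).
exists b => //; exists a; split.
  by apply: (pushout_epi po1); rewrite -morcompA ?bf ?bi ?af ?ai comp1m.
by apply: (pushout_epi po); rewrite -morcompA ?af ?ai ?bf ?bi comp1m.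
Qed.

Lemma pullback_mono Y Z Y' Z' (p : Mor Y Z) (f : Mor Z' Z)
    (p' : Mor Y' Z') (f' : Mor Y' Y) T (u v : Mor T Y') :
  is_pullback p f p' f' -> f' \oc u = f' \oc v -> p' \oc u = p' \oc v -> u = v.
Proof.
case=> comm univ uvf uvp; have [|w [_ w_uniq]] := univ T (f' \oc v) (p' \oc v).
  by rewrite !morcompA comm.
by rewrite -(w_uniq u) // (w_uniq v).
Qed.

Lemma pullback_lift Y Z Y' Z' (p : Mor Y Z) (f : Mor Z' Z)
    (p' : Mor Y' Z') (f' : Mor Y' Y) T (u : Mor T Y) (v : Mor T Z') :
  is_pullback p f p' f' -> p \oc u = f \oc v ->
  exists w, f' \oc w = u /\ p' \oc w = v.
Proof. by case=> _ univ /univ[w [? _]]; exists w. Qed.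

Lemma pullback_unique Y Z Y' Z' Y1 (p : Mor Y Z) (f : Mor Z' Z)
    (p' : Mor Y' Z') (f' : Mor Y' Y) (p1 : Mor Y1 Z') (f1 : Mor Y1 Y) :
  is_pullback p f p1 f1 -> is_pullback p f p' f' ->
  exists2 b, is_iso b & p' \oc b = p1.
Proof.
move=> pb1 pb; have [b [bf bp]] := pullback_lift pb (proj1 pb1).
have [a [af ap]] := pullback_lift pb1 (proj1 pb).
exists b => //; exists a; split.
  by apply: (pullback_mono pb1); rewrite morcompA ?af ?ap ?bf ?bp compm1.
by apply: (pullback_mono pb); rewrite morcompA ?bf ?bp ?af ?ap compm1.
Qed.

Lemma pushout_cokernel X Y Z X' Y' (i : Mor X Y) (p : Mor Y Z) (f : Mor X X')
    (i' : Mor X' Y') (f' : Mor Y Y') :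
  is_pushout i f i' f' -> is_cokernel i p ->
  exists2 p', p' \oc f' = p & is_cokernel i' p'.
Proof.
move=> po cp; have [|p' [pf pi]] := pushout_desc (u := p) (v := 0) po.
  by rewrite comp0m; case: cp.
exists p' => //; split=> // T t ti.
have [|u up] := cokernel_desc (t := t \oc f') cp.
  by rewrite -morcompA (proj1 po) morcompA ti comp0m.
exists u; split.
  by apply: (pushout_epi po); rewrite -morcompA ?pf ?pi ?ti ?compm0.
by move=> v vt; apply: (cokernel_epi cp); rewrite up -vt -morcompA pf.
Qed.

Lemma pullback_kernel X Y Z Y' Z' (i : Mor X Y) (p : Mor Y Z) (f : Mor Z' Z)
    (p' : Mor Y' Z') (f' : Mor Y' Y) :
  is_pullback p f p' f' -> is_kernel p i ->
  exists2 i', f' \oc i' = i & is_kernel p' i'.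
Proof.
move=> pb ki; have [|i' [fi pi]] := pullback_lift (u := i) (v := 0) pb.
  by rewrite compm0; case: ki.
exists i' => //; split=> // T t pt.
have [|u iu] := kernel_lift (t := f' \oc t) ki.
  by rewrite morcompA (proj1 pb) -morcompA pt compm0.
exists u; split.
  by apply: (pullback_mono pb); rewrite morcompA ?fi ?pi ?pt ?comp0m.
by move=> v vt; apply: (kernel_mono ki); rewrite iu -vt morcompA fi.
Qed.

(** * Biproducts and finite direct sums *)

Definition biproduct X Y S (i1 : Mor X S) (i2 : Mor Y S)
    (p1 : Mor S X) (p2 : Mor S Y) : Prop :=
  [/\ p1 \oc i1 = idm X, p2 \oc i2 = idm Y, p1 \oc i2 = 0, p2 \oc i1 = 0 &
      i1 \oc p1 + i2 \oc p2 = idm S].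

Lemma biproduct_ext X Y S (i1 : Mor X S) (i2 : Mor Y S)
    (p1 : Mor S X) (p2 : Mor S Y) T (u v : Mor T S) :
  biproduct i1 i2 p1 p2 -> p1 \oc u = p1 \oc v -> p2 \oc u = p2 \oc v -> u = v.
Proof.
case=> _ _ _ _ e uv1 uv2.
by rewrite -[u]comp1m -[v]comp1m -e !compDl -!morcompA uv1 uv2.
Qed.

Lemma biproduct_pair X Y S (i1 : Mor X S) (i2 : Mor Y S)
    (p1 : Mor S X) (p2 : Mor S Y) T (u : Mor T X) (v : Mor T Y) :
  biproduct i1 i2 p1 p2 ->
  exists w, p1 \oc w = u /\ p2 \oc w = v.
Proof.
case=> e1 e2 e12 e21 _; exists (i1 \oc u + i2 \oc v).
by rewrite !compDr !morcompA e1 e2 e12 e21 !comp0m !comp1m addr0 add0r.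
Qed.

(** Branching on [val i] makes the two members reduce to [X] and [Y], so components of a direct sum
    can be retyped by conversion, without transport. *)
Definition pair_fam X Y (i : 'I_2) : C := if val i == 0%N then X else Y.

Lemma biproduct_dirsum X Y S (i1 : Mor X S) (i2 : Mor Y S)
    (p1 : Mor S X) (p2 : Mor S Y) :
  biproduct i1 i2 p1 p2 -> is_dirsum (pair_fam X Y) S.
Proof.
case=> e1 e2 e12 e21 e.
exists (fun i => if val i == 0%N as b return Mor (if b then X else Y) S
                 then i1 else i2).
exists (fun i => if val i == 0%N as b return Mor S (if b then X else Y)
                 then p1 else p2).
split=> [[[|[|]]]|[[|[|]] // ?] [[|[|]] // ?]|] //.
by rewrite !big_ord_recl big_ord0 addr0.
Qed.

Lemma dirsum_biproduct X Y S : is_dirsum (pair_fam X Y) S ->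
  exists (i1 : Mor X S) (i2 : Mor Y S) (p1 : Mor S X) (p2 : Mor S Y),
    biproduct i1 i2 p1 p2.
Proof.
pose o0 : 'I_2 := ord0; pose o1 : 'I_2 := Ordinal (isT : 1 < 2)%N.
case=> [inj [proj [pi1 pi0 e]]].
exists (inj o0 : Mor X S), (inj o1 : Mor Y S).
exists (proj o0 : Mor S X), (proj o1 : Mor S Y); split.
- exact: (pi1 o0).
- exact: (pi1 o1).
- exact: (pi0 o0 o1).
- exact: (pi0 o1 o0).
- rewrite -e !big_ord_recl big_ord0 addr0.
  by have -> : lift ord0 ord0 = o1 by exact: val_inj.
Qed.

Lemma comp_suml (I : finType) X Y Z (g : I -> Mor Y Z) (f : Mor X Y) :
  (\sum_i g i) \oc f = \sum_i g i \oc f.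
Proof.
by apply: (big_morph (fun g : Mor Y Z => g \oc f)) => [u v|];
  rewrite ?compDl ?comp0m.
Qed.

Lemma comp_sumr (I : finType) X Y Z (g : Mor Y Z) (f : I -> Mor X Y) :
  g \oc (\sum_i f i) = \sum_i g \oc f i.
Proof.
by apply: (big_morph (fun f : Mor X Y => g \oc f)) => [u v|];
  rewrite ?compDr ?compm0.
Qed.

(** [Y] is an arbitrary direct sum of the tail, so its maps to and from [X] are assembled from the
    tail components of both sums. This drives the induction that closes [ML M] under finite direct
    sums. *)
Lemma dirsum_recl n (E : 'I_n.+1 -> C) X Y :
  is_dirsum E X -> is_dirsum (fun i => E (lift ord0 i)) Y ->
  exists (i1 : Mor (E ord0) X) (i2 : Mor Y X)
      (p1 : Mor X (E ord0)) (p2 : Mor X Y),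
    biproduct i1 i2 p1 p2.
Proof.
case=> [inj [proj [pi1 pi0 e]]] [inj' [proj' [pi1' pi0' e']]].
exists (inj ord0), (\sum_i inj (lift ord0 i) \oc proj' i).
exists (proj ord0), (\sum_i inj' i \oc proj (lift ord0 i)); split.
- exact: pi1.
- rewrite comp_sumr -e'; apply: eq_bigr => j _.
  rewrite comp_suml (bigD1 j) //= big1 => [|i nij].
    by rewrite addr0 -morcompA (morcompA (proj _)) pi1 comp1m.
  by rewrite -morcompA (morcompA (proj _)) pi0 ?comp0m ?compm0 //
     (inj_eq lift_inj).
- by rewrite comp_sumr big1 // => i _; rewrite morcompA pi0 ?comp0m.
- by rewrite comp_suml big1 // => i _; rewrite -morcompA pi0 ?compm0.
rewrite -e big_ord_recl; congr (_ + _).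
rewrite comp_suml; apply: eq_bigr => i _.
rewrite comp_sumr (bigD1 i) //= big1 => [|j nji].
  by rewrite addr0 -morcompA (morcompA (proj' _)) pi1' comp1m.
by rewrite -morcompA (morcompA (proj' _)) pi0' 1?eq_sym // comp0m compm0.
Qed.

End LinearCategory.

(** * Exact categories *)

Section ExactCategory.
Variables (k : fieldType) (B : exactCat k).
Implicit Types X Y Z T : B.

Let ex := @exact_exact k B.

Lemma conflation_kernel X Y Z (i : Mor X Y) (p : Mor Y Z) :
  conflation i p -> is_kernel p i.
Proof. exact: confl_kernel. Qed.

Lemma conflation_cokernel X Y Z (i : Mor X Y) (p : Mor Y Z) :
  conflation i p -> is_cokernel i p.
Proof. exact: confl_cokernel. Qed.

Lemma conflation_comp0 X Y Z (i : Mor X Y) (p : Mor Y Z) :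
  conflation i p -> p \oc i = 0.
Proof. by case/conflation_kernel. Qed.

(** A deflation comes with some conflation; kernels are unique up to isomorphism and conflations are
    stable under isomorphism. *)
Lemma deflation_kernel X Y Z (i : Mor X Y) (p : Mor Y Z) :
  deflation p -> is_kernel p i -> conflation i p.
Proof.
case=> X0 [i0 ip0] ki.
have [a iso_a ia] := kernel_unique (conflation_kernel ip0) ki.
apply: (confl_iso ex iso_a (is_iso_id Y) (is_iso_id Z) _ _ ip0).
  by rewrite comp1m.
by rewrite comp1m compm1.
Qed.

Lemma inflation_cokernel X Y Z (i : Mor X Y) (p : Mor Y Z) :
  inflation i -> is_cokernel i p -> conflation i p.
Proof.
case=> Z0 [p0 ip0] cp.
have [c iso_c cpE] := cokernel_unique (conflation_cokernel ip0) cp.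
apply: (confl_iso ex (is_iso_id X) (is_iso_id Y) iso_c _ _ ip0).
  by rewrite comp1m compm1.
by rewrite compm1.
Qed.

(** The axiom yields one pushout of [i] along [f] that is an inflation; uniqueness of pushouts
    transfers this to the given square, where the cokernel of [i'] is induced by [p] and 0. *)
Lemma pushout_conflation X Y Z X' Y' (i : Mor X Y) (p : Mor Y Z) (f : Mor X X')
    (i' : Mor X' Y') (f' : Mor Y Y') :
  is_pushout i f i' f' -> conflation i p ->
  exists2 p', p' \oc f' = p & conflation i' p'.
Proof.
move=> po ip; have infl_i : inflation i by exists Z, p.
have [Y1 [i1 [f1 [po1 [Z1 [p1 ip1]]]]]] := inflation_pushout ex f infl_i.
have [b iso_b bi] := pushout_unique po1 po.
have [p' p'f cp'] := pushout_cokernel po (conflation_cokernel ip).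
exists p' => //; apply: inflation_cokernel => //.
have [b' [b'b bb']] := iso_b; exists Z1, (p1 \oc b').
apply: (confl_iso ex (is_iso_id X') iso_b (is_iso_id Z1) _ _ ip1).
  by rewrite compm1.
by rewrite comp1m -morcompA b'b compm1.
Qed.

Lemma pullback_conflation X Y Z Y' Z' (i : Mor X Y) (p : Mor Y Z) (f : Mor Z' Z)
    (p' : Mor Y' Z') (f' : Mor Y' Y) :
  is_pullback p f p' f' -> conflation i p ->
  exists2 i', f' \oc i' = i & conflation i' p'.
Proof.
move=> pb ip; have defl_p : deflation p by exists X, i.
have [Y1 [p1 [f1 [pb1 [X1 [i1 ip1]]]]]] := deflation_pullback ex f defl_p.
have [b iso_b pb1E] := pullback_unique pb1 pb.
have [i' fi' ki'] := pullback_kernel pb (conflation_kernel ip).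
exists i' => //; apply: deflation_kernel => //.
exists X1, (b \oc i1).
apply: (confl_iso ex (is_iso_id X1) iso_b (is_iso_id Z') _ _ ip1).
  by rewrite compm1.
by rewrite comp1m.
Qed.

Lemma pushout_exists X Y Z X' (i : Mor X Y) (p : Mor Y Z) (f : Mor X X') :
  conflation i p ->
  exists Y' (i' : Mor X' Y') (f' : Mor Y Y') p',
    [/\ is_pushout i f i' f', conflation i' p' & p' \oc f' = p].
Proof.
move=> ip; have [|Y' [i' [f' [po _]]]] := inflation_pushout ex (i := i) f.
  by exists Z, p.
by have [p' p'f ip'] := pushout_conflation po ip; exists Y', i', f', p'.
Qed.

Lemma pullback_exists X Y Z Z' (i : Mor X Y) (p : Mor Y Z) (f : Mor Z' Z) :
  conflation i p ->
  exists Y' i' (p' : Mor Y' Z') (f' : Mor Y' Y),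
    [/\ is_pullback p f p' f', conflation i' p' & f' \oc i' = i].
Proof.
move=> ip; have [|Y' [p' [f' [pb _]]]] := deflation_pullback ex (p := p) f.
  by exists X, i.
by have [i' fi' ip'] := pullback_conflation pb ip; exists Y', i', p', f'.
Qed.

Lemma pullback_deflation Y Z Y' Z' (p : Mor Y Z) (f : Mor Z' Z)
    (p' : Mor Y' Z') (f' : Mor Y' Y) :
  is_pullback p f p' f' -> deflation p -> deflation p'.
Proof.
move=> pb [X [i ip]].
by have [i' _ ip'] := pullback_conflation pb ip; exists X, i'.
Qed.

Lemma retraction_biproduct X Y Z (i : Mor X Y) (p : Mor Y Z) (r : Mor Y X) :
  conflation i p -> r \oc i = idm X ->
  exists s : Mor Z Y, biproduct i s r p.
Proof.
move=> ip ri.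
have [|s sp] := cokernel_desc (t := idm Y - i \oc r) (conflation_cokernel ip).
  by rewrite compBl comp1m -morcompA ri compm1 subrr.
have epi_p := cokernel_epi (conflation_cokernel ip).
exists s; split=> //; last by rewrite sp addrC subrK.
- apply: epi_p; rewrite -morcompA sp compBr morcompA (conflation_comp0 ip).
  by rewrite comp0m subr0 compm1 comp1m.
- by apply: epi_p; rewrite -morcompA sp compBr morcompA ri comp1m compm1
       comp0m subrr.
- exact: conflation_comp0.
Qed.

(* The direct sum of two deflations is a composite of two pullbacks of them:
   first [d1 (+) 1], then [1 (+) d2]. *)
Lemma biproduct_conflation
    X1 X2 X (i1 : Mor X1 X) (i2 : Mor X2 X) (p1 : Mor X X1) (p2 : Mor X X2)
    Y1 Y2 Y (j1 : Mor Y1 Y) (j2 : Mor Y2 Y) (q1 : Mor Y Y1) (q2 : Mor Y Y2)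
    Z1 Z2 Z (l1 : Mor Z1 Z) (l2 : Mor Z2 Z) (r1 : Mor Z Z1) (r2 : Mor Z Z2)
    (a1 : Mor X1 Y1) (d1 : Mor Y1 Z1) (a2 : Mor X2 Y2) (d2 : Mor Y2 Z2) :
  biproduct i1 i2 p1 p2 -> biproduct j1 j2 q1 q2 -> biproduct l1 l2 r1 r2 ->
  conflation a1 d1 -> conflation a2 d2 ->
  exists (a : Mor X Y) (d : Mor Y Z), conflation a d.
Proof.
move=> bX bY bZ ad1 ad2.
have [a [q1a q2a]] := biproduct_pair (a1 \oc p1) (a2 \oc p2) bY.
have [d [r1d r2d]] := biproduct_pair (d1 \oc q1) (d2 \oc q2) bZ.
exists a, d; apply: deflation_kernel; last first.
  split.
    apply: (biproduct_ext bZ); rewrite compm0 morcompA ?r1d ?r2d -morcompA.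
      by rewrite q1a morcompA (conflation_comp0 ad1) comp0m.
    by rewrite q2a morcompA (conflation_comp0 ad2) comp0m.
  move=> T t dt.
  have [|u1 au1] := kernel_lift (t := q1 \oc t) (conflation_kernel ad1).
    by rewrite morcompA -r1d -morcompA dt compm0.
  have [|u2 au2] := kernel_lift (t := q2 \oc t) (conflation_kernel ad2).
    by rewrite morcompA -r2d -morcompA dt compm0.
  have [u [p1u p2u]] := biproduct_pair u1 u2 bX.
  exists u; split.
    by apply: (biproduct_ext bY); rewrite morcompA ?q1a ?q2a -morcompA
      ?p1u ?p2u.
  move=> v av; apply: (biproduct_ext bX); rewrite ?p1u ?p2u.
    apply: (kernel_mono (conflation_kernel ad1)).
    by rewrite au1 -av !morcompA q1a.
  apply: (kernel_mono (conflation_kernel ad2)).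
  by rewrite au2 -av !morcompA q2a.
(* [S] is the intermediate sum of [Z1] and [Y2]; [u] applies [d1] to the first summand, [v] applies
   [d2] to the second. *)
have [S dS] := exact_additive (pair_fam Z1 Y2).
have [m1 [m2 [s1 [s2 bS]]]] := dirsum_biproduct dS.
have [u [s1u s2u]] := biproduct_pair (d1 \oc q1) q2 bS.
have [v [r1v r2v]] := biproduct_pair s1 (d2 \oc s2) bZ.
have -> : d = v \oc u.
  apply: (biproduct_ext bZ); rewrite morcompA ?r1d ?r2d ?r1v ?r2v -?morcompA.
    by rewrite s1u.
  by rewrite s2u.
apply: (deflation_comp ex).
- have defl_d2 : deflation d2 by exists X2, a2.
  apply: (pullback_deflation (p := d2) (f := r2) (f' := s2)) => //.
  split=> // T x y xy; have [w [s1w s2w]] := biproduct_pair (r1 \oc y) x bS.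
  exists w; split.
    split=> //; apply: (biproduct_ext bZ).
      by rewrite morcompA r1v.
    by rewrite morcompA r2v -morcompA s2w.
  move=> w' [s2w' vw']; apply: (biproduct_ext bS); rewrite ?s2w ?s2w' //.
  by rewrite s1w -vw' morcompA r1v.
have defl_d1 : deflation d1 by exists X1, a1.
apply: (pullback_deflation (p := d1) (f := s1) (f' := q1)) => //.
split=> // T x y xy; have [w [q1w q2w]] := biproduct_pair x (s2 \oc y) bY.
exists w; split.
  split=> //; apply: (biproduct_ext bS).
    by rewrite morcompA s1u -morcompA q1w.
  by rewrite morcompA s2u.
move=> w' [q1w' uw']; apply: (biproduct_ext bY); rewrite ?q1w ?q1w' //.
by rewrite q2w -uw' morcompA s2u.
Qed.

End ExactCategory.

(** * Rigid contravariantly finite subcategories *)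

Section RigidSubcategory.
Variables (k : fieldType) (B : exactCat k) (M : subcat B).
Implicit Types X Y Z T N : B.

Lemma subcat_biproduct X Y S (i1 : Mor X S) (i2 : Mor Y S)
    (p1 : Mor S X) (p2 : Mor S Y) :
  biproduct i1 i2 p1 p2 -> M X -> M Y -> M S.
Proof.
move=> bS MX MY; apply: subcat_dirsum (biproduct_dirsum bS) => i.
by rewrite /pair_fam; case: ifP.
Qed.

Lemma factors0 X Y : factors M (0 : Mor X Y).
Proof.
apply/asboolP.
change ((0 : Mor X Y) \in @factors_pred k B M X Y).
exact: rpred0.
Qed.

Lemma factorsB X Y (f g : Mor X Y) :
  factors M f -> factors M g -> factors M (f - g).
Proof.
move=> Mf Mg; apply/asboolP; change (f - g \in @factors_pred k B M X Y).
by apply: rpredB; apply/asboolP.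
Qed.

Lemma factors_compl X Y Z (g : Mor Y Z) (f : Mor X Y) :
  factors M f -> factors M (g \oc f).
Proof.
by case=> N [h [l [MN ->]]]; exists N, (g \oc h), l; rewrite morcompA.
Qed.

Lemma factors_through N X Y (h : Mor N Y) (g : Mor X N) :
  M N -> factors M (h \oc g).
Proof. by exists N, h, g. Qed.

Lemma ML_biproduct X Y S (i1 : Mor X S) (i2 : Mor Y S)
    (p1 : Mor S X) (p2 : Mor S Y) :
  biproduct i1 i2 p1 p2 -> ML M X -> ML M Y -> ML M S.
Proof.
move=> bS [X0 [X1 [a1 [d1 [MX0 MX1 c1]]]]] [Y0 [Y1 [a2 [d2 [MY0 MY1 c2]]]]].
have [S0 dS0] := exact_additive (pair_fam X0 Y0).
have [? [? [? [? bS0]]]] := dirsum_biproduct dS0.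
have [S1 dS1] := exact_additive (pair_fam X1 Y1).
have [? [? [? [? bS1]]]] := dirsum_biproduct dS1.
have [a [d ad]] := biproduct_conflation bS bS0 bS1 c1 c2.
exists S0, S1, a, d; split=> //.
  exact: subcat_biproduct bS0 MX0 MY0.
exact: subcat_biproduct bS1 MX1 MY1.
Qed.

Lemma ML_dirsum n (E : 'I_n -> B) X :
  is_dirsum E X -> (forall i, ML M (E i)) -> ML M X.
Proof.
elim: n E X => [|n IHn] E X dX MLE.
  (* [X] is a zero object, hence in [M]. The cokernel [Z] of [idm X] is zero as well, since its
     projection [p] is both epi and zero. *)
  have [Z [p xp]] := inflation_id (@exact_exact k B) X.
  have MX : M X by apply: subcat_dirsum dX; case.
  exists X, Z, (idm X), p; split=> //.
  apply: (@subcat_dirsum _ _ M 0 E); first by case.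
  exists (fun=> 0), (fun=> 0); split; try by case.
  rewrite big_ord0; apply: (cokernel_epi (conflation_cokernel xp)).
  by rewrite comp0m comp1m -[p]compm1 (conflation_comp0 xp).
have [Y dY] := exact_additive (fun i => E (lift ord0 i)).
have [? [? [? [? bX]]]] := dirsum_recl dX dY.
exact: ML_biproduct bX (MLE _) (IHn _ _ dY _).
Qed.

(** * Consequences of rigidity *)

Hypothesis M_rigid : rigid M.

(** The retraction of the equivalent split extension is pulled back along the equivalence [h]. *)
Lemma rigid_retraction X Y Z (i : Mor X Y) (p : Mor Y Z) :
  conflation i p -> M X -> M Z -> exists r, r \oc i = idm X.
Proof.
move=> ip MX MZ.
have [e0 [[r [s [ri _ _ _]]] [h [hi _]]]] := M_rigid MZ MX (Extension ip).
by exists (r \oc h); rewrite -morcompA hi.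
Qed.

Lemma rigid_extension_closed X Y Z (i : Mor X Y) (p : Mor Y Z) :
  conflation i p -> M X -> M Z -> M Y.
Proof.
move=> ip MX MZ; have [r ri] := rigid_retraction ip MX MZ.
by have [s bY] := retraction_biproduct ip ri; apply: subcat_biproduct bY _ _.
Qed.

(** Pushing out along [t] gives an extension of [Z] by [N], which splits. For [Y] in [M] this makes
    [i] a left [M]-approximation. *)
Lemma rigid_extend X Y Z N (i : Mor X Y) (p : Mor Y Z) (t : Mor X N) :
  conflation i p -> M Z -> M N -> exists h, h \oc i = t.
Proof.
move=> ip MZ MN; have [G [i' [t' [p' [po ip' _]]]]] := pushout_exists t ip.
have [r ri] := rigid_retraction ip' MN MZ.
by exists (r \oc t'); rewrite -morcompA (proj1 po) morcompA ri comp1m.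
Qed.

Lemma factors_extend X Y Z T (i : Mor X Y) (p : Mor Y Z) (t : Mor X T) :
  conflation i p -> M Z -> factors M t -> exists h, h \oc i = t.
Proof.
move=> ip MZ [N [h [g [MN ->]]]]; have [h' h'i] := rigid_extend g ip MZ MN.
by exists (h \oc h'); rewrite -morcompA h'i.
Qed.

(** The pushout [W] of [j] and [c] is an extension of [N] by [Y0], hence in [M], and also an
    extension of [Y1] by [Z]. If [u \oc c] factors through [M] it extends to [Y0], so [u] factors
    through [W]; thus [c] is epi modulo [[M]]. *)
Lemma ML_extension Y Z N (c : Mor Y Z) (rho : Mor Z N) :
  ML M Y -> conflation c rho -> M N ->
  ML M Z /\ forall T (u : Mor Z T), factors M (u \oc c) -> factors M u.
Proof.
move=> [Y0 [Y1 [j [q [MY0 MY1 jq]]]]] crho MN.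
have [W [z [w [z' [po zz' _]]]]] := pushout_exists c jq.
have [w' _ ww'] := pushout_conflation (pushout_sym po) crho.
have MW : M W by exact: rigid_extension_closed ww' _ _.
split; first by exists W, Y1, z, z'.
move=> T u /(factors_extend jq MY1)[h hj].
have [v [_ <-]] := pushout_desc po hj.
exact: factors_through.
Qed.

Hypothesis B_enough_projectives : enough_projectives B.
Hypothesis M_projectives : forall P : B, is_projective P -> M P.
Hypothesis M_contravariantly_finite : contravariantly_finite M.

(* If [a : N -> E] is a right approximation and [P -> E] a projective cover
   with kernel [O], the pushout of [O -> P] along [O -> N x_E P] is an extension
   of [N] by [P], hence in [M], and it surjects onto [E]. *)
Lemma deflation_approximation E : exists N (d : Mor N E),
  [/\ M N, deflation d &
      forall N' (g : Mor N' E), M N' -> exists h, d \oc h = g].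
Proof.
have [N [a [MN a_approx]]] := M_contravariantly_finite E.
have [P [p [/M_projectives MP [O [o op]]]]] := B_enough_projectives E.
have [Q [o' [q [q' [pb oq q'o]]]]] := pullback_exists a op.
have [D [b [b' [d [po bd db']]]]] := pushout_exists o' op.
have [n nb b'n] := pushout_conflation (pushout_sym po) oq.
exists D, d; split; [exact: rigid_extension_closed b'n _ _ | by exists Q, b |].
have [|r [rb' rb]] := pushout_desc (u := idm P) (v := q') po.
  by rewrite comp1m q'o.
have [s [_ ns _ _ e]] := retraction_biproduct b'n rb'.
(* The retraction [r] splits [D] into [P] and [N]. On the summand [N], [d] is [a] up to sign, so it
   inherits the approximation property. *)
have ds : d \oc s = - a.
  apply: (cokernel_epi (conflation_cokernel oq)).
  have sq : s \oc q = b - b' \oc q'.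
    by rewrite -rb -nb -[X in X - _]comp1m -e compDl -!morcompA addrC addKr.
  rewrite -morcompA sq compBr morcompA db' (conflation_comp0 bd) sub0r.
  by rewrite compNl (proj1 pb).
move=> N' g /a_approx -/(_ g)[h ah]; exists (- (s \oc h)).
by rewrite -compNl morcompA -[- s]sub0r compBr compm0 ds sub0r opprK.
Qed.

(* In [ML / [M]], the morphism [ka] is a kernel of [x], although [E] need not
   lie in [ML]. *)
Lemma conflation_cover X E N (x : Mor X E) (p : Mor E N) :
  conflation x p -> M N ->
  exists K (ka : Mor K X), [/\ ML M K, factors M (x \oc ka),
    forall T (t : Mor T X), factors M (x \oc t) -> exists u, ka \oc u = t,
    forall T (u : Mor T K), ML M T -> factors M (ka \oc u) -> factors M u &
    forall T (g : Mor X T), factors M (g \oc ka) -> exists e, e \oc x = g].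
Proof.
move=> xp MN; have [N0 [d [MN0 defl_d d_approx]]] := deflation_approximation E.
have [L [l ld]] := defl_d.
have [K [l' [ka [m [pb lka ml']]]]] := pullback_exists x ld.
have dmE : d \oc m = x \oc ka := proj1 pb.
(* The pullback [K] of [d] along [x] is also the kernel of the composite deflation [p \oc d]; this
   puts [K] in [ML M]. *)
have mp : conflation m (p \oc d).
  apply: deflation_kernel.
    by apply: (deflation_comp (@exact_exact k B)) => //; exists X, x.
  split; first by rewrite -morcompA dmE morcompA (conflation_comp0 xp) comp0m.
  move=> T t pt.
  have [|v xv] := kernel_lift (t := d \oc t) (conflation_kernel xp).
    by rewrite morcompA.
  have [u [mu kau]] := pullback_lift pb (esym xv).
  exists u; split=> // u' mu'; apply: (pullback_mono pb); rewrite ?mu //.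
  apply: (kernel_mono (conflation_kernel xp)).
  by rewrite !morcompA -dmE -!morcompA mu mu'.
exists K, ka; split.
- by exists N0, N, m, (p \oc d).
- by rewrite -dmE; apply: factors_through.
- move=> T t [N' [h [g [MN' xt]]]]; have [h' hE] := d_approx _ h MN'.
  have [|u [_ kau]] := pullback_lift (u := h' \oc g) (v := t) pb.
    by rewrite xt -hE morcompA.
  by exists u.
- move=> T u [T0 [T1 [j [q [MT0 MT1 jq]]]]] /(factors_extend jq MT1)[h hj].
  have [h' hE] := d_approx _ (x \oc h) MT0.
  have [y [my kay]] := pullback_lift pb hE.
  (* Subtracting a morphism through [T0] reduces to the case of a morphism killed by [ka]. *)
  pose v := u - y \oc j.
  have kav : ka \oc v = 0 by rewrite compBr morcompA kay hj subrr.
  have [a aj] := rigid_extend (m \oc v) jq MT1 MN0.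
  have [|b bq] := cokernel_desc (t := d \oc a) (conflation_cokernel jq).
    by rewrite -morcompA aj morcompA dmE -morcompA kav compm0.
  (* The extension [a] of [m \oc v] need not be killed by [d], but [d \oc a] descends to [T1].
     Correcting by [b' \oc q] kills it without changing the restriction to [T]. *)
  have [b' bE] := d_approx _ b MT1.
  have [|z [mz kaz]] := pullback_lift (u := a - b' \oc q) (v := 0) pb.
    by rewrite compm0 compBr morcompA bE bq subrr.
  have vE : v = z \oc j.
    apply: (pullback_mono pb); last by rewrite kav morcompA kaz comp0m.
    by rewrite morcompA mz compBl aj -morcompA (conflation_comp0 jq)
      compm0 subr0.
  have -> : u = (z + y) \oc j by rewrite compDl -vE subrK.
  exact: factors_through.
- move=> T g /(factors_extend mp MN)[r rm].
  (* On [K] the map [r] restricts to [g \oc ka], which vanishes on [L]; so [r] descends along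
     [d]. *)
  have [|e ed] := cokernel_desc (t := r) (conflation_cokernel ld).
    by rewrite -ml' morcompA rm -morcompA (conflation_comp0 lka) compm0.
  exists e; apply: (cokernel_epi (conflation_cokernel lka)).
  by rewrite -morcompA -dmE morcompA ed rm.
Qed.

End RigidSubcategory.

(** * The quotient category *)

Section QuotientMorphisms.
Variables (k : fieldType) (B : exactCat k) (M : subcat B).
Implicit Types X Y Z T : ML_mod_M M.

(* An object of the quotient, typed in [B]: [Mor (base X) (base Y)] is a Hom
   space of [B], whereas [Mor (sval X) (sval Y)] would be one of [B / [M]]. *)
Definition base X : B := sval X.

Definition cls X Y (f : Mor (base X) (base Y)) : Mor X Y :=
  qpi (factor_ideal M) f.

Lemma cls_surj X Y (f : Mor X Y) : exists f0, f = cls f0.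
Proof. by exists (repr f); rewrite /cls qpi_surj. Qed.

Lemma cls_comp X Y Z (g : Mor (base Y) (base Z)) (f : Mor (base X) (base Y)) :
  @cls Y Z g \oc @cls X Y f = cls (g \oc f).
Proof. exact: qpi_comp. Qed.

Lemma cls_eq X Y (f g : Mor (base X) (base Y)) :
  @cls X Y f = cls g <-> factors M (f - g).
Proof.
split=> [/(qpiP (factor_ideal M))/asboolP // | Mfg].
by apply/(qpiP (factor_ideal M)); apply/asboolP.
Qed.

Lemma cls_linear X Y : linear (@cls X Y).
Proof. exact: qpi_linear. Qed.

Lemma clsD X Y (f g : Mor (base X) (base Y)) : @cls X Y (f + g) = cls f + cls g.
Proof. by have := @cls_linear X Y 1 f g; rewrite !scale1r. Qed.

Lemma cls0 X Y : @cls X Y 0 = 0.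
Proof. by apply: (addIr (@cls X Y 0)); rewrite -clsD !add0r. Qed.

Lemma cls_eq0 X Y (f : Mor (base X) (base Y)) : @cls X Y f = 0 <-> factors M f.
Proof. by rewrite -cls0 cls_eq subr0. Qed.

(** A criterion on representatives: lifts need only exist up to [[M]]. The difference of two lifts
    is sent into [[M]] by [i], so the last hypothesis gives uniqueness. *)
Lemma cls_kernel X Y Z (f : Mor (base Y) (base Z)) (i : Mor (base X) (base Y)) :
  factors M (f \oc i) ->
  (forall T (t : Mor (base T) (base Y)), factors M (f \oc t) ->
    exists u, factors M (i \oc u - t)) ->
  (forall T (u : Mor (base T) (base X)), factors M (i \oc u) -> factors M u) ->
  is_kernel (@cls Y Z f) (@cls X Y i).
Proof.
move=> fi0 ker_ex ker_uniq; split; first by rewrite cls_comp cls_eq0.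
move=> T t; have [t0 ->] := cls_surj t; rewrite cls_comp cls_eq0.
move=> /ker_ex[u iu]; exists (cls u); split; first by rewrite cls_comp cls_eq.
move=> v; have [v0 ->] := cls_surj v; rewrite cls_comp cls_eq => iv.
apply/cls_eq/ker_uniq; rewrite compBr.
have -> : i \oc u - i \oc v0 = (i \oc u - t0) - (i \oc v0 - t0).
  by rewrite opprB addrA subrK.
exact: factorsB.
Qed.

Lemma cls_cokernel X Y Z (f : Mor (base X) (base Y))
    (p : Mor (base Y) (base Z)) :
  factors M (p \oc f) ->
  (forall T (t : Mor (base Y) (base T)), factors M (t \oc f) ->
    exists u, factors M (u \oc p - t)) ->
  (forall T (u : Mor (base Z) (base T)), factors M (u \oc p) -> factors M u) ->
  is_cokernel (@cls X Y f) (@cls Y Z p).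
Proof.
move=> pf0 coker_ex coker_uniq; split; first by rewrite cls_comp cls_eq0.
move=> T t; have [t0 ->] := cls_surj t; rewrite cls_comp cls_eq0.
move=> /coker_ex[u up]; exists (cls u); split; first by rewrite cls_comp cls_eq.
move=> v; have [v0 ->] := cls_surj v; rewrite cls_comp cls_eq => vp.
apply/cls_eq/coker_uniq; rewrite compBl.
have -> : u \oc p - v0 \oc p = (u \oc p - t0) - (v0 \oc p - t0).
  by rewrite opprB addrA subrK.
exact: factorsB.
Qed.

Lemma mono_cls X Y (f : Mor (base X) (base Y)) T (u : Mor (base T) (base X)) :
  mono (@cls X Y f) -> factors M (f \oc u) -> factors M u.
Proof.
move=> mono_f fu; apply/(@cls_eq0 T X)/mono_f.
by rewrite compm0 cls_comp cls_eq0.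
Qed.

Lemma epi_cls X Y (f : Mor (base X) (base Y)) T (u : Mor (base Y) (base T)) :
  epi (@cls X Y f) -> factors M (u \oc f) -> factors M u.
Proof.
move=> epi_f uf; apply/(@cls_eq0 Y T)/epi_f.
by rewrite comp0m cls_comp cls_eq0.
Qed.

Lemma ML_mod_M_additive : additive_cat (ML_mod_M M).
Proof.
move=> n E; have [X dX] := @exact_additive k B n (fun i => base (E i)).
have MLX : ML M X by apply: ML_dirsum dX (fun i => svalP (E i)).
have [inj [proj [pi1 pi0 e]]] := dX.
pose S : ML_mod_M M := exist _ X MLX.
exists S, (fun i => @cls (E i) S (inj i)), (fun i => @cls S (E i) (proj i)).
split=> [i|i j nij|].
- by rewrite cls_comp pi1.
- by rewrite cls_comp pi0 // cls0.
- under eq_bigr do rewrite cls_comp.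
  rewrite -(big_morph (@cls S S) (@clsD S S) (cls0 S S)).
  by congr (@cls S S _); exact: e.
Qed.

End QuotientMorphisms.

(** * Kernels, cokernels and normality modulo [[M]] *)

Section Abelian.
Variables (k : fieldType) (B : exactCat k) (M : subcat B).
Hypothesis M_rigid : rigid M.
Hypothesis B_enough_projectives : enough_projectives B.
Hypothesis M_projectives : forall P : B, is_projective P -> M P.
Hypothesis M_contravariantly_finite : contravariantly_finite M.

(* The pullback of [X -> M0 -> M1] along [rho g : N -> M1]; when [g] is a right
   approximation of the cokernel [Z] of [f], its class generates the kernel of
   [Ext^1(-, f)] on [M]. *)
Lemma pulled_back_extension (X Y Z M0 M1 N : B) (i : Mor X M0) (q : Mor M0 M1)
    (f : Mor X Y) (c : Mor Y Z) (i2 : Mor M0 Z) (rho : Mor Z M1) (g : Mor N Z) :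
  conflation i q -> is_pushout i f c i2 -> conflation c rho -> rho \oc i2 = q ->
  exists (E : B) (x : Mor X E) (p0 : Mor E M0) (p1 : Mor E N) (de : Mor E Y),
    [/\ conflation x p1, is_pullback q (rho \oc g) p1 p0, p0 \oc x = i,
        c \oc de = i2 \oc p0 - g \oc p1 & de \oc x = f].
Proof.
move=> iq po crho rhoi2.
have [E [x [p1 [p0 [pb xp1 p0x]]]]] := pullback_exists (rho \oc g) iq.
(* Both maps from [E] to [Z] agree after [rho], so their difference comes from [Y]; the lift [de]
   extends [f] along [x]. *)
have [|de cde] := kernel_lift (t := i2 \oc p0 - g \oc p1)
  (conflation_kernel crho).
  by rewrite compBr !morcompA rhoi2 (proj1 pb) subrr.
exists E, x, p0, p1, de; split=> //.
apply: (kernel_mono (conflation_kernel crho)).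
rewrite morcompA cde compBl -!morcompA p0x (conflation_comp0 xp1).
by rewrite compm0 subr0 (proj1 po).
Qed.

(** If [t \oc f] factors through [M], it extends along [i] to [M0], and the pushout property then
    makes [t] factor through [c] strictly. *)
Lemma cls_pushout_cokernel (X Y Z : ML_mod_M M) (M0 M1 : B)
    (i : Mor (base X) M0) (q : Mor M0 M1) (f : Mor (base X) (base Y))
    (c : Mor (base Y) (base Z)) (i2 : Mor M0 (base Z)) (rho : Mor (base Z) M1) :
  M M0 -> M M1 -> conflation i q -> is_pushout i f c i2 -> conflation c rho ->
  is_cokernel (@cls _ _ _ X Y f) (@cls _ _ _ Y Z c).
Proof.
move=> MM0 MM1 iq po crho; apply: cls_cokernel.
- by rewrite -(proj1 po); apply: factors_through.
- move=> T t /(factors_extend M_rigid iq MM1)[h /esym tf].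
  have [u [_ uc]] := pushout_desc po (esym tf).
  exists u; rewrite uc subrr; exact: factors0.
- by move=> T u; apply: (proj2 (ML_extension M_rigid (svalP Y) crho MM1)).
Qed.

Lemma ML_mod_M_cokernel (X Y : ML_mod_M M) (f : Mor X Y) :
  exists (Z : ML_mod_M M) (p : Mor Y Z), is_cokernel f p.
Proof.
have [f0 ->] := cls_surj f; have [M0 [M1 [i [q [MM0 MM1 iq]]]]] := svalP X.
have [Z [c [i2 [rho [po crho _]]]]] := pushout_exists f0 iq.
have [MLZ _] := ML_extension M_rigid (svalP Y) crho MM1.
exists (exist _ Z MLZ), (@cls _ _ _ Y (exist _ Z MLZ) c).
exact: (cls_pushout_cokernel (Z := exist _ Z MLZ)) MM0 MM1 iq po crho.
Qed.

(* [g : N -> Z] approximates the cokernel [Z] of [f], and [ka] covers the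
   extension [x : X -> E] obtained from [g]. *)
Lemma cls_cover_kernel (X Y K : ML_mod_M M) (Z M0 M1 N E : B)
    (i : Mor (base X) M0) (q : Mor M0 M1) (f : Mor (base X) (base Y))
    (c : Mor (base Y) Z) (i2 : Mor M0 Z) (rho : Mor Z M1) (g : Mor N Z)
    (x : Mor (base X) E) (p0 : Mor E M0) (p1 : Mor E N) (de : Mor E (base Y))
    (ka : Mor (base K) (base X)) :
  M M0 -> M N -> is_pushout i f c i2 -> conflation c rho ->
  rho \oc i2 = q ->
  (forall N' (g' : Mor N' Z), M N' -> exists h, g \oc h = g') ->
  conflation x p1 -> is_pullback q (rho \oc g) p1 p0 -> p0 \oc x = i ->
  de \oc x = f -> factors M (x \oc ka) ->
  (forall T (t : Mor T (base X)), factors M (x \oc t) ->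
    exists u, ka \oc u = t) ->
  (forall T (u : Mor T (base K)), ML M T ->
    factors M (ka \oc u) -> factors M u) ->
  is_kernel (@cls _ _ _ X Y f) (@cls _ _ _ K X ka).
Proof.
move=> MM0 MN po crho rhoi2 g_approx xp1 pb p0x dex xka ka_lift ka_mono.
apply: cls_kernel.
- by rewrite -dex -morcompA; apply: factors_compl.
- move=> T t; have [T0 [T1 [j [r [MT0 MT1 jr]]]]] := svalP T.
  move=> /(factors_extend M_rigid jr MT1)[h hj].
  (* It suffices to extend [x \oc t] to a map [w] from [T0] to the pullback [E]. Its component in
     [M0] is [a], extending [i \oc t]; its component in [N] is [b' \oc r], which vanishes on [T]. *)
  have [a aj] := rigid_extend M_rigid (i \oc t) jr MT1 MM0.
  have [|b br] := cokernel_desc (t := i2 \oc a - c \oc h)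
    (conflation_cokernel jr).
    by rewrite compBl -!morcompA aj hj !morcompA (proj1 po) subrr.
  have [b' gb'] := g_approx _ b MT1.
  have [|w [p0w p1w]] := pullback_lift (u := a) (v := b' \oc r) pb.
    rewrite -morcompA (morcompA g) gb' br compBr !morcompA rhoi2.
    by rewrite (conflation_comp0 crho) comp0m subr0.
  have xt : x \oc t = w \oc j.
    apply: (pullback_mono pb); rewrite !morcompA ?p0x ?p0w ?p1w ?aj //.
    by rewrite (conflation_comp0 xp1) -morcompA (conflation_comp0 jr)
      comp0m compm0.
  have [|u kau] := ka_lift _ t; first by rewrite xt; apply: factors_through.
  exists u; rewrite kau subrr; exact: factors0.
- by move=> T u; apply: ka_mono; apply: svalP T.
Qed.

Lemma ML_mod_M_kernel (X Y : ML_mod_M M) (f : Mor X Y) :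
  exists (K : ML_mod_M M) (i : Mor K X), is_kernel f i.
Proof.
have [f0 ->] := cls_surj f; have [M0 [M1 [i [q [MM0 MM1 iq]]]]] := svalP X.
have [Z [c [i2 [rho [po crho rhoi2]]]]] := pushout_exists f0 iq.
have [N [g [MN g_approx]]] := M_contravariantly_finite Z.
have [E [x [p0 [p1 [de [xp1 pb p0x _ dex]]]]]] :=
  pulled_back_extension g iq po crho rhoi2.
have [K [ka [MLK xka ka_lift ka_mono _]]] :=
  conflation_cover M_rigid B_enough_projectives M_projectives
    M_contravariantly_finite xp1 MN.
exists (exist _ K MLK), (@cls _ _ _ (exist _ K MLK) X ka).
exact: (cls_cover_kernel (K := exist _ K MLK)) MM0 MN po crho rhoi2
  g_approx xp1 pb p0x dex xka ka_lift ka_mono.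
Qed.

Lemma ML_mod_M_mono_normal (X Y : ML_mod_M M) (f : Mor X Y) :
  mono f -> exists (Z : ML_mod_M M) (g : Mor Y Z), is_kernel g f.
Proof.
have [f0 ->] := cls_surj f => mono_f.
have [M0 [M1 [i [q [MM0 MM1 iq]]]]] := svalP X.
have [Z [c [i2 [rho [po crho rhoi2]]]]] := pushout_exists f0 iq.
have [MLZ _] := ML_extension M_rigid (svalP Y) crho MM1.
exists (exist _ Z MLZ), (@cls _ _ _ Y (exist _ Z MLZ) c).
apply: cls_kernel.
- by rewrite -(proj1 po); apply: factors_through.
- move=> T t; have [T0 [T1 [j [r [MT0 MT1 jr]]]]] := svalP T.
  move=> /(factors_extend M_rigid jr MT1)[h hj].
  (* The extension is pulled back along [h] itself, with [T0] as its end term, instead of along an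
     approximation of [Z]. *)
  have [E [x [p0 [p1 [de [xp1 pb _ cde dex]]]]]] :=
    pulled_back_extension h iq po crho rhoi2.
  have [K [ka [MLK xka _ _ ka_ext]]] :=
    conflation_cover M_rigid B_enough_projectives M_projectives
      M_contravariantly_finite xp1 MT0.
  have Mka : factors M ka.
    apply: (mono_cls (T := exist _ K MLK) mono_f).
    by rewrite -dex -morcompA; apply: factors_compl.
  (* Since [ka] factors through [M], the identity of [X] extends along [x]: the extension splits. *)
  have [|e ex] := ka_ext _ (idm (base X)); first by rewrite comp1m.
  have [s [_ p1s _ _ _]] := retraction_biproduct xp1 ex.
  (* Restricted to [T], the section [s] followed by [p0] is killed by [q], so it lands in [X]; this
     [y] is the lift of [t], with error [de \oc s \oc j] through [T0]. *)
  have [|y iy] := kernel_lift (t := p0 \oc s \oc j) (conflation_kernel iq).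
    rewrite !morcompA (proj1 pb) -(morcompA _ p1) p1s compm1 -morcompA hj.
    by rewrite morcompA (conflation_comp0 crho) comp0m.
  exists y.
  have -> : f0 \oc y - t = de \oc s \oc j; last exact: factors_through.
  apply: (kernel_mono (conflation_kernel crho)).
  rewrite compBr !morcompA cde -(proj1 po) -morcompA iy compBl.
  by rewrite compBl -(morcompA h) p1s compm1 hj !morcompA.
- by move=> T u; apply: mono_cls.
Qed.

Lemma ML_mod_M_epi_normal (X Y : ML_mod_M M) (f : Mor X Y) :
  epi f -> exists (Z : ML_mod_M M) (g : Mor Z X), is_cokernel g f.
Proof.
have [f0 ->] := cls_surj f => epi_f.
have [M0 [M1 [i [q [MM0 MM1 iq]]]]] := svalP X.
have [Z [c [i2 [rho [po crho rhoi2]]]]] := pushout_exists f0 iq.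
have [MLZ Z_uniq] := ML_extension M_rigid (svalP Y) crho MM1.
have [N [g [MN g_approx]]] := M_contravariantly_finite Z.
have [E [x [p0 [p1 [de [xp1 pb p0x _ dex]]]]]] :=
  pulled_back_extension g iq po crho rhoi2.
have [K [ka [MLK xka ka_lift ka_mono ka_ext]]] :=
  conflation_cover M_rigid B_enough_projectives M_projectives
    M_contravariantly_finite xp1 MN.
exists (exist _ K MLK), (@cls _ _ _ (exist _ K MLK) X ka).
(* Because [f0] is epi modulo [[M]], [c] factors through [M], hence so does the identity of [Z]; the
   approximation [g] therefore splits. *)
have [s gs] : exists s, g \oc s = idm Z.
  have [|N' [h [l [MN' e]]]] := Z_uniq _ (idm Z).
    rewrite comp1m; apply: (epi_cls (T := exist _ Z MLZ) epi_f).
    by rewrite -(proj1 po); apply: factors_through.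
  by have [h' gh'] := g_approx _ h MN'; exists (h' \oc l); rewrite morcompA gh'.
have [|si [p0si p1si]] := pullback_lift (u := 0) (v := s \oc c) pb.
  rewrite compm0 -morcompA (morcompA g) gs comp1m.
  by rewrite (conflation_comp0 crho).
have [|ta [p0ta p1ta]] := pullback_lift (u := idm M0) (v := s \oc i2) pb.
  by rewrite compm1 -morcompA (morcompA g) gs comp1m.
(* The section [s] yields maps to [E] from [Y] and from [M0], so [x] equals [- (si \oc f0)] up to a
   map through [M0]. *)
have xE : x = ta \oc i - si \oc f0.
  apply: (pullback_mono pb); rewrite compBr !morcompA.
    by rewrite p0x p0ta p0si comp1m comp0m subr0.
  by rewrite (conflation_comp0 xp1) p1ta p1si -!morcompA (proj1 po) subrr.
apply: cls_cokernel.
- by rewrite -dex -morcompA; apply: factors_compl.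
(* The sign of the witness comes from the decomposition [xE]; the remaining term passes through
   [M0]. *)
- move=> T t /ka_ext[e <-]; exists (- (e \oc si)).
  rewrite xE compBr opprB compNl -morcompA addrA addNr sub0r morcompA.
  by rewrite -compNl; apply: factors_through.
- by move=> T u; apply: epi_cls.
Qed.

End Abelian.

Theorem corollary3p3 (k : fieldType) (B : exactCat k)
  (B_hom_finite : hom_finite B)
  (B_krull_schmidt : krull_schmidt B)
  (B_enough_projectives : enough_projectives B)
  (B_enough_injectives : enough_injectives B)
  (M : subcat B)
  (M_projectives : forall P : B, is_projective P -> M P)
  (M_rigid : rigid M)
  (M_contravariantly_finite : contravariantly_finite M) :
  abelian_cat (ML_mod_M M).
Proof.
split.
- exact: ML_mod_M_additive.
- exact: ML_mod_M_kernel.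
- exact: ML_mod_M_cokernel.
- exact: ML_mod_M_mono_normal.
- exact: ML_mod_M_epi_normal.
Qed.
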